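(* Let $s\ge 2$ and $1\le d\le s$ be integers and let $1\le r\le\binom{s}{d}$. For $s<2d-r+2$, we have $$d_r(C_d^{\mathbb{P}})=(q-2)^{s-d-1}(q-1)^{d-r}\left[(q-1)^r-1\right].$$
   Context: $K=\mathbb{F}_q$ is the finite field with $q$ elements, $q$ a power of a prime, and $S=K[t_1,\dots,t_s]$. $KV_d$ is the $K$-span of the square-free monomials of degree $d$ in $S$, i.e. monomials $t_1^{a_1}\cdots t_s^{a_s}$ with all $a_i\in\{0,1\}$ and $\sum_{i=1}^s a_i=d$. The projective torus $\mathbb{T}$ is the image of $(\mathbb{F}_q^* )^s$ in projective space $\mathbb{P}^{s-1}$ over $K$; its points are represented by the vectors with first entry $1$, so $\mathbb{T}=\{1\}\times(\mathbb{F}_q^* )^{s-1}=\{Q_1,\dots,Q_{\bar m}\}$, $\bar m=(q-1)^{s-1}$. The projective toric code $C_d^{\mathbb{P}}$ (over the $d$-th hypersimplex) is the image of $KV_d\to\mathbb{F}_q^{\bar m}$, $g\mapsto(g(Q_1),\dots,g(Q_{\bar m}))$. $V_{\mathbb{T}}(H)$ denotes the set of common zeros in $\mathbb{T}$ of the polynomials in $H$. For $1\le r\le\dim_K KV_d$, the $r$-th generalized Hamming weight of $C_d^{\mathbb{P}}$ is given by $$d_r(C_d^{\mathbb{P}}):=\min\{|\mathbb{T}\setminus V_{\mathbb{T}}(H)| : H=\{f_1,\dots,f_r\}\subseteq KV_d \text{ is linearly independent over } K\}.$$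
   Formalization: For q = 2 and d = s (so r = 1) the right-hand side is 0^{-1}·0, undefined; there it is read after cancelling (q-2)^{-1}[(q-1)-1] = 1, that is as (q-1)^{s-1} = 1. *)

(* Defs.v *)
(* Written for the Mathematical Components library and its multinomials. *)
From HB Require Import structures.
From mathcomp Require Export all_boot all_order all_algebra.
From mathcomp Require Export mpoly.

Set Implicit Arguments.
Unset Strict Implicit.
Unset Printing Implicit Defensive.

Import GRing.Theory.
Local Open Scope ring_scope.

Section ProjectiveToricCode.
Variables (K : finFieldType) (s : nat).

Definition sqfree_mnm (d : nat) (m : 'X_{1..s}) : bool :=
  (mdeg m == d) && [forall i : 'I_s, (m i <= 1)%N].

(* Bounding the degree by d.+1 only serves to make the index type finite. *)
Definition in_KV (d : nat) (p : {mpoly K[s]}) : Prop :=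
  exists c : 'X_{1..s < d.+1} -> K,
    p = \sum_(m : 'X_{1..s < d.+1} | sqfree_mnm d m) c m *: 'X_[m].

(* Each point of the projective torus is given by its representative whose
   first coordinate is 1. *)
Definition torus : {set {ffun 'I_s -> K}} :=
  [set P : {ffun 'I_s -> K} |
     [forall i, P i != 0] && [forall i : 'I_s, (i == 0 :> nat)%N ==> (P i == 1)]].

Definition lin_indep (r : nat) (f : 'I_r -> {mpoly K[s]}) : Prop :=
  forall c : 'I_r -> K, \sum_(i < r) c i *: f i = 0 -> forall i, c i = 0.

Definition zeros (r : nat) (f : 'I_r -> {mpoly K[s]}) :
    {set {ffun 'I_s -> K}} :=
  [set P in torus | [forall i, (f i).@[P] == 0]].

Definition is_min (E : nat -> Prop) (w : nat) : Prop :=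
  E w /\ (forall n, E n -> (w <= n)%N).

(* w is the r-th generalized Hamming weight of the projective toric code over
   the d-th hypersimplex.  Linear independence is that of the polynomials, not
   of the codewords; the two differ when K has 2 elements, as evaluation on
   the torus is then not injective in general. *)
Definition is_ghw (d r w : nat) : Prop :=
  is_min (fun n => exists f : 'I_r -> {mpoly K[s]},
            [/\ forall i, in_KV d (f i),
                lin_indep f
              & n = #|torus :\: zeros f|]) w.

End ProjectiveToricCode.

(* The exponents are integers: s - d - 1 is -1 when d = s.  For q = 2 and
   d = s (hence r = 1) the expression below is 0^-1 * 0; it is then read after
   the cancellation (q - 2)^-1 * [(q - 1) - 1] = 1, that is as
   (q - 1)^(s - 1) = 1. *)
Definition ghw_formula (q s d r : nat) : rat :=
  if (q == 2)%N && (d == s) then 1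
  else (q%:R - 2) ^ (s%:Z - d%:Z - 1) * (q%:R - 1) ^ (d%:Z - r%:Z)
       * ((q%:R - 1) ^+ r - 1).

(* Main.v *)
(* Write f = f0 + x f1 with f0, f1 free of the variable x.  Given an r-dimensional
   space W of such polynomials, let W0 be the space of the f0 and W1 the space of
   the f1 with f0 = 0, so that r = dim W0 + dim W1.  Over a point where W0 does not
   vanish identically, at most one value x != 0 is a common zero of W, and over a
   point where W1 does not vanish identically none is.  With Q = q - 1 and
   p = 1 - 1/Q, induction on the number of variables gives at least
     Q^(s-1) p^(s-d) (1 + 1/Q + ... + 1/Q^(r-1))
   nonzeros on the torus, which is the value claimed.  It is attained by
     (a_1 - b_1) ... (a_(s-d-1) - b_(s-d-1)) (Y / y_i - Y / z),  1 <= i <= r,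
   where Y is the product of the remaining variables, among which are z and the
   y_i; the inequality between s, d and r says that there are enough of them. *)
From HB Require Import structures.
Require Import Defs.
From mathcomp Require Import ring zify.
Import GRing.Theory Order.TTheory Num.Theory.
Local Open Scope ring_scope.

Set Implicit Arguments.
Unset Strict Implicit.
Unset Printing Implicit Defensive.

(** * Finite geometric sums *)

Definition geom (x : rat) r := \sum_(i < r) x ^+ i.

Lemma geomD x a b : geom x (a + b) = geom x a + x ^+ a * geom x b.
Proof.
rewrite /geom big_split_ord mulr_sumr /=; congr (_ + _).
by apply: eq_bigr => i _; rewrite exprD.
Qed.

Lemma geom_ge0 x r : 0 <= x -> 0 <= geom x r.
Proof. by move=> x0; apply: sumr_ge0 => i _; apply: exprn_ge0. Qed.

Lemma geomM x r : (1 - x) * geom x r = 1 - x ^+ r.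
Proof. by rewrite /geom -opprB mulNr -subrX1 opprB. Qed.

(** * Subtori, with some coordinates frozen at 1 *)

Section Subtorus.
Variables (K : finFieldType) (I : finType).
Implicit Types (J : {set I}) (P : {ffun I -> K}) (j : I).

(** Freezing the other coordinates instead of removing them keeps all subtori in one type, so the
    induction on [J] never changes the index type. *)
Definition subtorus J : {set {ffun I -> K}} :=
  [set P : {ffun I -> K} | [forall i, if i \in J then P i != 0 else P i == 1]].

Definition upd P j (x : K) : {ffun I -> K} :=
  [ffun i => if i == j then x else P i].

Lemma subtorusP J P :
  reflect ((forall i, i \in J -> P i != 0) /\ (forall i, i \notin J -> P i = 1))
          (P \in subtorus J).
Proof.
rewrite inE; apply: (iffP forallP) => [H | [H1 H2] i].
  split=> i iJ; have := H i; first by rewrite iJ.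
  by rewrite (negbTE iJ) => /eqP.
by case: ifPn => [/H1 | /H2 ->].
Qed.

(** Resetting coordinate [j] to 1 and recording its former value is inverse to [upd]. *)
Lemma sum_subtorus j J (F : {ffun I -> K} -> nat) : j \in J ->
  (\sum_(P in subtorus J) F P =
   \sum_(P in subtorus (J :\ j)) \sum_(x : K | x != 0%R) F (upd P j x))%N.
Proof.
move=> jJ; rewrite pair_big_dep /=.
rewrite (reindex_onto (fun u : {ffun I -> K} * K => upd u.1 j u.2)
                      (fun P => (upd P j 1, P j))) /=; last first.
  move=> P _; apply/ffunP => i; rewrite !ffunE; by case: eqP => // ->.
apply: eq_bigl => -[P x] /=; rewrite ffunE eqxx.
apply/andP/andP => [[/subtorusP[H1 H2] /eqP [E]]|[/subtorusP[H1 H2] x0]].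
- split; last by have := H1 j jJ; rewrite ffunE eqxx.
  apply/subtorusP; split=> i; rewrite !inE.
    case/andP=> nij /H1; by rewrite ffunE (negbTE nij).
  rewrite negb_and negbK -E !ffunE; case: eqP => //= nij /H2.
  by rewrite ffunE; case: eqP.
- split; last first.
    apply/eqP; congr (_, _); apply/ffunP => i; rewrite !ffunE.
    by case: eqP => // ->; rewrite H2 // !inE eqxx.
  apply/subtorusP; split=> i iJ; rewrite ffunE.
    by case: (eqVneq i j) => // nij; apply: H1; rewrite !inE nij.
  case: (eqVneq i j) => [E|nij]; first by rewrite -E (negbTE iJ) in jJ.
  by apply: H2; rewrite !inE (negbTE iJ) andbF.
Qed.

Lemma card_neq0 : #|[pred x : K | x != 0]| = #|K|.-1.
Proof. by rewrite -(cardC1 (0 : K)); apply: eq_card. Qed.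

Lemma subtorus0 : subtorus set0 = [set [ffun=> 1]].
Proof.
apply/setP => P; rewrite [RHS]inE; apply/subtorusP/eqP => [[_ H]|->].
  by apply/ffunP => i; rewrite ffunE H // inE.
by split=> i; rewrite ?inE // ffunE.
Qed.

Lemma card_subtorus J : #|subtorus J| = (#|K|.-1 ^ #|J|)%N.
Proof.
move: {2}#|J| (erefl #|J|) => n; elim: n J => [|n IHn] J nJ.
  by rewrite nJ (cards0_eq nJ) subtorus0 cards1.
have /card_gt0P [j jJ] : (0 < #|J|)%N by rewrite nJ.
have nJ' : #|J :\ j| = n by have := cardsD1 j J; rewrite jJ nJ => -[].
rewrite -sum1_card (sum_subtorus _ jJ).
under eq_bigr do rewrite sum1_card card_neq0.
by rewrite sum_nat_const IHn nJ' // nJ expnSr.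
Qed.

End Subtorus.

(** * Square-free polynomials as coefficient functions on sets of variables *)

Section Coefficients.
Variables (K : finFieldType) (I : finType).
Implicit Types (J A : {set I}) (P : {ffun I -> K}) (j z : I).

Local Notation coefs := {ffun {set I} -> K^o}.
Implicit Types (c : coefs) (W : {vspace coefs}).

Definition eval P c : K^o := \sum_A c A * \prod_(i in A) P i.
(** For f = f0 + x f1 with x the variable [j], [drop] extracts f0 and [link] extracts f1. *)
Definition drop j c : coefs := [ffun A : {set I} => if j \in A then 0 else c A].
Definition link j c : coefs := [ffun A : {set I} => if j \in A then 0 else c (j |: A)].

Lemma eval_linear P : linear (eval P).
Proof.
move=> a u v; rewrite /eval scaler_sumr -big_split /=; apply: eq_bigr => A _.
by rewrite !ffunE /GRing.scale /= mulrDl mulrA.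
Qed.
HB.instance Definition _ P :=
  GRing.isLinear.Build K coefs K^o *:%R (eval P) (eval_linear P).

Lemma drop_linear j : linear (drop j).
Proof.
move=> a u v; apply/ffunP => A; rewrite !ffunE.
by case: ifP; rewrite ?scaler0 ?addr0.
Qed.
HB.instance Definition _ j :=
  GRing.isLinear.Build K coefs coefs *:%R (drop j) (drop_linear j).

Lemma link_linear j : linear (link j).
Proof.
move=> a u v; apply/ffunP => A; rewrite !ffunE.
by case: ifP; rewrite ?scaler0 ?addr0.
Qed.
HB.instance Definition _ j :=
  GRing.isLinear.Build K coefs coefs *:%R (link j) (link_linear j).

Lemma eval_split j P c : eval P c = eval P (drop j c) + P j * eval P (link j c).
Proof.
rewrite /eval (bigID (fun A : {set I} => j \in A)) /= addrC; congr (_ + _).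
  rewrite big_mkcond; apply: eq_bigr => A _; rewrite ffunE.
  by case: (j \in A); rewrite //= mul0r.
rewrite [in RHS](bigID (fun A : {set I} => j \in A)) /=.
rewrite [X in _ * (X + _)]big1 ?add0r => [|A jA]; last first.
  by rewrite ffunE jA mul0r.
rewrite mulr_sumr (reindex_onto (fun A => j |: A) (fun A => A :\ j)) /=; last first.
  by move=> A jA; rewrite setD1K.
apply: eq_big => [A|A /andP[_ /eqP E]].
  rewrite setU11 /=; apply/eqP/idP => [<-|jA]; first by rewrite !inE eqxx.
  by rewrite setU1K.
have jA : j \notin A by rewrite -E !inE eqxx.
by rewrite ffunE (negbTE jA) big_setU1 //= mulrCA.
Qed.

Lemma eval_upd j x P c : (forall A, j \in A -> c A = 0) ->
  eval (upd P j x) c = eval P c.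
Proof.
move=> H; apply: eq_bigr => A _; have [/H->|jA] := boolP (j \in A).
  by rewrite !mul0r.
congr (_ * _); apply: eq_bigr => i iA; rewrite ffunE; case: eqP => // E.
by rewrite -E iA in jA.
Qed.

Definition supported A d c := forall B, c B != 0 -> B \subset A /\ #|B| = d.

Definition nonzeros J W : {set {ffun I -> K}} :=
  [set P in subtorus K J | ~~ (W <= lker (linfun (eval P)))%VS].

Lemma nonzerosP P W :
  reflect (exists2 c, c \in W & eval P c != 0) (~~ (W <= lker (linfun (eval P)))%VS).
Proof.
apply: (iffP (@subvPn _ _ W _)) => -[c cW]; rewrite ?memv_ker ?lfunE => H; exists c => //.
by rewrite memv_ker lfunE.
Qed.

(** [dropv] and [linkv] are the spaces W0 and W1; the kernel of [drop] singles out the f with f0 =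
    0. *)
Definition dropv j W := (linfun (drop j) @: W)%VS.
Definition linkv j W := (linfun (link j) @: (W :&: lker (linfun (drop j))))%VS.

Lemma drop_link_inj j c : drop j c = 0 -> link j c = 0 -> c = 0.
Proof.
move=> /ffunP d0 /ffunP l0; apply/ffunP => A; rewrite ffunE.
have [jA|jA] := boolP (j \in A); last by have := d0 A; rewrite !ffunE (negbTE jA).
by have := l0 (A :\ j); rewrite !ffunE !inE eqxx /= setD1K.
Qed.

(** Rank-nullity for [drop] on [W]; [link] is injective on the kernel because f0 and f1 together
    determine f. *)
Lemma dim_drop_link j W : (\dim W = \dim (dropv j W) + \dim (linkv j W))%N.
Proof.
suff E : (W :&: lker (linfun (drop j)) :&: lker (linfun (link j)) = 0)%VS.
  by rewrite -(limg_ker_dim (linfun (drop j)) W) /linkv (limg_dim_eq E) addnC.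
apply/eqP; rewrite -subv0; apply/subvP => c.
rewrite !memv_cap !memv_ker !lfunE /= => /andP[/andP[_ /eqP d0] /eqP l0].
by rewrite memv0 (drop_link_inj d0 l0).
Qed.

(** If some f with f0 = 0 has f1 nonzero at [P], then x f1 is nonzero for all q - 1 values of x.
    Otherwise, if some f0 is nonzero at [P], then f0 + x f1 has at most one root, which leaves at
    least q - 2 values. *)
Lemma fibre_bound j W P :
  ((#|K|.-2 * (~~ (dropv j W <= lker (linfun (eval P)))%VS
              || ~~ (linkv j W <= lker (linfun (eval P)))%VS)
   + ~~ (linkv j W <= lker (linfun (eval P)))%VS)%N
  <= \sum_(x : K | x != 0%R)
       ~~ (W <= lker (linfun (eval (upd P j x))))%VS)%N.
Proof.
have dropE x c : eval (upd P j x) (drop j c) = eval P (drop j c).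
  by apply: eval_upd => A jA; rewrite ffunE jA.
have linkE x c : eval (upd P j x) (link j c) = eval P (link j c).
  by apply: eval_upd => A jA; rewrite ffunE jA.
have evE x c : eval (upd P j x) c = eval P (drop j c) + x * eval P (link j c).
  by rewrite (eval_split j) dropE linkE ffunE eqxx.
have q1 : (1 < #|K|)%N := card_finNzRing_gt1 K.
have [/nonzerosP[_ /memv_imgP[c + ->]]|_] :=
    boolP (~~ (linkv j W <= lker (linfun (eval P)))%VS).
  rewrite memv_cap memv_ker !lfunE /= => /andP[cW /eqP c0] l0.
  rewrite orbT muln1 addn1 (eq_bigr (fun=> 1%N)) => [|x x0].
    by rewrite sum1_card card_neq0; case: #|K| q1 => [|[]].
  suff -> : ~~ (W <= lker (linfun (eval (upd P j x))))%VS by [].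
  by apply/nonzerosP; exists c; rewrite // evE c0 linear0 add0r mulf_neq0.
rewrite orbF addn0.
have [/nonzerosP[_ /memv_imgP[c + ->]]|_] :=
    boolP (~~ (dropv j W <= lker (linfun (eval P)))%VS); last by rewrite muln0.
rewrite !lfunE /= => cW d0.
(* The only possible root. When f1 vanishes at [P], division by zero makes [x0] equal to 0, a value
   already excluded. *)
set x0 : K := - eval P (drop j c) / eval P (link j c).
rewrite muln1; apply: (@leq_trans (\sum_(x : K | (x != 0%R) && (x != x0)) 1)%N).
  rewrite sum1_card.
  have -> : #|[pred x | (x != 0) && (x != x0)]| = #|~: [set (0 : K); x0]|.
    by apply: eq_card => x; rewrite !inE negb_or.
  have E : (#|[set 0%R; x0]| + #|~: [set 0%R; x0]| = #|K|)%N := cardsC _.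
  (* [b] tells whether 0 and [x0] differ, so one or two values are removed from [K]. *)
  have aux k n (b : bool) : (b.+1 + n = k -> k.-2 <= n)%N by case: b; lia.
  by apply: aux; rewrite -[RHS]E cards2.
rewrite big_mkcondr; apply: leq_sum => x _; case: eqP => //= /eqP nx.
suff -> : ~~ (W <= lker (linfun (eval (upd P j x))))%VS by [].
apply/nonzerosP; exists c; rewrite // evE; apply: contra nx.
have [->|l0] := eqVneq (eval P (link j c)) 0.
  by rewrite mulr0 addr0 (negbTE d0).
rewrite addrC addr_eq0 => /eqP E.
by rewrite /x0 -E mulfK.
Qed.

Lemma card_nonzeros J W :
  #|nonzeros J W| =
  (\sum_(P in subtorus K J) ~~ (W <= lker (linfun (eval P)))%VS)%N.
Proof. by rewrite -sum1dep_card big_mkcondr. Qed.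

(** [fibre_bound] summed over the base. Keeping the union lets the induction bound it below by W0 or
    by W1. *)
Lemma nonzeros_split j J W : j \in J ->
  (#|K|.-2 * #|nonzeros (J :\ j) (dropv j W) :|: nonzeros (J :\ j) (linkv j W)|
   + #|nonzeros (J :\ j) (linkv j W)| <= #|nonzeros J W|)%N.
Proof.
move=> jJ; rewrite [#|nonzeros J W|]card_nonzeros (sum_subtorus _ jJ).
rewrite [X in (_ + X)%N]card_nonzeros.
have -> : nonzeros (J :\ j) (dropv j W) :|: nonzeros (J :\ j) (linkv j W) =
  [set P in subtorus K (J :\ j) |
     ~~ (dropv j W <= lker (linfun (eval P)))%VS
     || ~~ (linkv j W <= lker (linfun (eval P)))%VS].
  by apply/setP => P; rewrite !inE -andb_orr.
rewrite -sum1dep_card big_mkcondr big_distrr /= -big_split /=.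
by apply: leq_sum => P _; apply: leq_trans (fibre_bound j W P).
Qed.

Lemma supported_drop z j J d c : supported (z |: J) d c ->
  supported (z |: J :\ j) d (drop j c).
Proof.
move=> cJ A; rewrite ffunE; case: ifPn; rewrite ?eqxx // => jA /cJ[sA cA].
split=> //; apply/subsetP => i iA; have := subsetP sA i iA.
by rewrite !inE; case: eqP => //= _ ->; rewrite andbT; apply: contra jA => /eqP<-.
Qed.

Lemma supported_link z j J d c B : supported (z |: J) d c -> link j c B != 0 ->
  B \subset z |: J :\ j /\ #|B|.+1 = d.
Proof.
move=> cJ; rewrite ffunE; case: ifPn; rewrite ?eqxx // => jB /cJ[sB cB].
split; last by move: cB; rewrite cardsU1 jB.
apply/subsetP => i iB; have := subsetP sB i; rewrite !inE iB orbT => /(_ isT).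
by case: eqP => //= _ ->; rewrite andbT; apply: contra jB => /eqP<-.
Qed.

Lemma supported0 A d W : (forall c, c \in W -> supported A d c) ->
  (#|A| < d)%N -> W = 0%VS.
Proof.
move=> WA dA; apply/eqP; rewrite -subv0; apply/subvP => c /WA cA.
rewrite memv0; apply/eqP/ffunP => B; rewrite ffunE; apply/eqP.
apply: contraTT dA => /cA[/subset_leq_card sB <-]; by rewrite -leqNgt.
Qed.

(** * The lower bound on the number of nonzeros *)

Local Notation q1 := (#|K|.-1%:R : rat).

Lemma q1_ge1 : 1 <= q1.
Proof. by rewrite ler1n; have := card_finNzRing_gt1 K; case: #|K| => [|[]]. Qed.

Lemma q1M : #|K|.-2%:R = q1 * (1 - q1^-1).
Proof.
rewrite mulrBr mulr1 divff ?gt_eqF ?(lt_le_trans ltr01 q1_ge1) //.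
have := card_finNzRing_gt1 K; case: #|K| => [|[|n]] //= _.
by rewrite -(natrB _ (ltn0Sn n)) subn1.
Qed.

Lemma q1V_ge0 : 0 <= q1^-1.
Proof. by rewrite invr_ge0 ler0n. Qed.

Lemma q1V_le1 : q1^-1 <= 1.
Proof. by rewrite invf_le1 ?q1_ge1 // (lt_le_trans ltr01 q1_ge1). Qed.

(** At most one subset of [[set z]] has [d] elements, so [W] lies on the line spanned by its
    indicator [v]; for [d] > 1 there is none and [W] is zero. *)
Lemma dim_delta d z W : (forall c, c \in W -> supported [set z] d c) ->
  (\dim W <= 1)%N.
Proof.
move=> WJ; pose A := if d is 0 then set0 else [set z].
pose v : coefs := [ffun B => (B == A)%:R].
suff sWv : (W <= <[v]>)%VS by rewrite (leq_trans (dimvS sWv)) // dim_vline leq_b1.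
apply/subvP => c /WJ cz; apply/vlineP; exists (c A); apply/ffunP => B.
rewrite !ffunE /GRing.scale /=; case: eqP => [->|BA]; first by rewrite mulr1.
rewrite mulr0; apply/eqP; apply: contra_notT BA => /cz[].
rewrite /A subset1 => /orP[] /eqP ->; rewrite ?cards1 ?cards0 => <- //.
Qed.

(** The variable [z] is the one set to 1, and [e] is the number of variables minus the degree. In
    the induction on [#|J|], W0 keeps the degree and lowers [e], while W1 lowers the degree and
    keeps [e]. *)
Lemma nonzeros_bound z J d e W : z \notin J -> (#|J|.+1 = d + e)%N ->
    (forall c, c \in W -> supported (z |: J) d c) ->
  q1 ^+ #|J| * (1 - q1^-1) ^+ e * geom q1^-1 (\dim W) <= #|nonzeros J W|%:R.
Proof.
have x0 := q1V_ge0; have x1 := q1V_le1.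
have p0 : 0 <= 1 - q1^-1 by rewrite subr_ge0.
have p1 : 1 - q1^-1 <= 1 by rewrite lerBlDr lerDl.
have Q0 : 0 < q1 := lt_le_trans ltr01 q1_ge1.
move: {2}#|J| (erefl #|J|) => n; elim: n J d e W => [|n IHn] J d e W nJ zJ de WJ.
  (* Only [z] is left: a nonzero [W] is spanned by one monomial, which is 1 at the single point, and
     p^e <= 1 suffices. *)
  rewrite nJ expr0 mul1r; move: WJ; rewrite (cards0_eq nJ) setU0 => WJ.
  have := dim_delta WJ; case: (posnP (\dim W)) => [->|dW dW1].
    by rewrite /geom big_ord0 mulr0 ler0n.
  have -> : \dim W = 1%N by apply/eqP; rewrite eqn_leq dW1.
  rewrite /geom big_ord1 expr0 mulr1 (le_trans (exprn_ile1 e p0 p1)) // ler1n.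
  have W0 : vpick W != 0 by rewrite vpick0 -dimv_eq0 -lt0n.
  have [B cB] : exists B, vpick W B != 0.
    apply/existsP; apply: contraNT W0; rewrite negb_exists => /forallP H.
    by apply/eqP/ffunP => B; rewrite ffunE; apply/eqP; have := H B; rewrite negbK.
  apply/card_gt0P; exists [ffun=> 1]; rewrite inE subtorus0 inE eqxx /=.
  apply/nonzerosP; exists (vpick W); first exact: memv_pick.
  rewrite /eval (bigD1 B) //= [X in _ + X]big1 ?addr0.
    by rewrite big1 ?mulr1 // => i _; rewrite ffunE.
  move=> A nA; have [->|cA] := eqVneq (vpick W A) 0; first by rewrite mul0r.
  case/negP: nA; move: (WJ _ (memv_pick W)) => H.
  have [+ cardA] := H A cA; have [+ cardB] := H B cB.
  rewrite !subset1 => /orP[]/eqP EB /orP[]/eqP EA; move: cardA cardB;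
    by rewrite EA EB ?cards0 ?cards1 => <-.
have /card_gt0P [j jJ] : (0 < #|J|)%N by rewrite nJ.
have nJ' : #|J :\ j| = n by have := cardsD1 j J; rewrite jJ nJ => -[].
have zJ' : z \notin J :\ j by rewrite !inE negb_and zJ orbT.
have W0J c : c \in dropv j W -> supported (z |: J :\ j) d c.
  by case/memv_imgP => c' /WJ c'J ->; rewrite lfunE; apply: supported_drop.
have W1J c : c \in linkv j W -> supported (z |: J :\ j) d.-1 c.
  case/memv_imgP => c'; rewrite memv_cap => /andP[/WJ c'J _] -> B.
  by rewrite lfunE => /(supported_link c'J)[? <-].
(* For [d] = 0 the equation between [#|J|], [d] and [e] fails at [d.-1], so the induction hypothesis
   does not cover W1; but then W1 is zero. *)
have W1d : d = 0%N -> linkv j W = 0%VS.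
  move=> d0; apply/eqP; rewrite -subv0; apply/subvP => c.
  case/memv_imgP => c'; rewrite memv_cap => /andP[/WJ c'J _] ->.
  rewrite memv0 lfunE; apply/eqP/ffunP => B; rewrite [RHS]ffunE; apply/eqP.
  by apply: contra_eqT d0 => /(supported_link c'J)[_ <-].
have B1 : q1 ^+ n * (1 - q1^-1) ^+ e * geom q1^-1 (\dim (linkv j W))
          <= #|nonzeros (J :\ j) (linkv j W)|%:R.
  have [/W1d ->|d0] := posnP d; first by rewrite dimv0 /geom big_ord0 mulr0 ler0n.
  by rewrite -{1}nJ'; apply: (IHn _ d.-1) => //; lia.
have := nonzeros_split W jJ.
rewrite -(ler_nat rat) natrD natrM q1M; apply: le_trans.
rewrite (dim_drop_link j W) geomD nJ.
(* If W0 = 0, the nonzeros of W1 bound both terms, and (q - 2) + 1 = Q gives the missing factor. *)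
have [->|r0] := posnP (\dim (dropv j W)).
  rewrite /geom big_ord0 add0r expr0 mul1r -/(geom _ _).
  apply: (@le_trans _ _ (q1 * #|nonzeros (J :\ j) (linkv j W)|%:R)).
    by rewrite exprS -!mulrA ler_pM2l // !mulrA.
  have : (#|nonzeros (J :\ j) (linkv j W)| <= #|nonzeros (J :\ j) (dropv j W)
            :|: nonzeros (J :\ j) (linkv j W)|)%N.
    by apply/subset_leq_card/subsetUr.
  rewrite -(ler_nat rat) => H.
  have -> : q1 * #|nonzeros (J :\ j) (linkv j W)|%:R =
     q1 * (1 - q1^-1) * #|nonzeros (J :\ j) (linkv j W)|%:R
     + #|nonzeros (J :\ j) (linkv j W)|%:R :> rat.
    by field; rewrite gt_eqF.
  by rewrite lerD2r ler_wpM2l // mulr_ge0 // ltW.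
(* For [e] = 0 the degree exceeds the number of variables left, which would make W0 zero. *)
have e0 : (0 < e)%N.
  rewrite lt0n; apply: contraTneq r0 => e0.
  rewrite (@supported0 (z |: J :\ j) d (dropv j W)) ?dimv0 //.
  by rewrite cardsU1 zJ' nJ'; lia.
have B0 : q1 ^+ n * (1 - q1^-1) ^+ e.-1 * geom q1^-1 (\dim (dropv j W))
          <= #|nonzeros (J :\ j) (dropv j W)|%:R.
  by rewrite -{1}nJ'; apply: (IHn _ d) => //; lia.
have BU : (#|nonzeros (J :\ j) (dropv j W)| <= #|nonzeros (J :\ j) (dropv j W)
            :|: nonzeros (J :\ j) (linkv j W)|)%N.
  by apply/subset_leq_card/subsetUl.
move: BU; rewrite -(ler_nat rat) => BU.
apply: le_trans (lerD (ler_wpM2l _ (le_trans B0 BU)) B1); last first.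
  by rewrite mulr_ge0 // ltW.
case: e e0 {de B0 IHn B1} => // e _ /=.
set G0 := geom _ _; set G1 := geom _ _; set X := q1^-1 ^+ _.
(* This holds because W0 has positive dimension; the two bounds together exceed the target by a
   nonnegative multiple of [1 - q1 * X]. *)
have X1 : q1 * X <= 1.
  rewrite /X -(prednK r0) exprS mulrA divff ?gt_eqF // mul1r.
  exact: exprn_ile1.
rewrite -subr_ge0.
have -> : q1 * (1 - q1^-1) * (q1 ^+ n * (1 - q1^-1) ^+ e * G0)
   + q1 ^+ n * (1 - q1^-1) ^+ e.+1 * G1
   - q1 ^+ n.+1 * (1 - q1^-1) ^+ e.+1 * (G0 + X * G1)
   = q1 ^+ n * (1 - q1^-1) ^+ e.+1 * G1 * (1 - q1 * X) by rewrite !exprS; ring.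
by rewrite !mulr_ge0 ?geom_ge0 ?subr_ge0 ?exprn_ge0 // ltW.
Qed.
End Coefficients.

(** * Translation between polynomials and coefficient functions *)

Section SquareFreePolynomials.
Variables (K : finFieldType) (s : nat).
Implicit Types (p : {mpoly K[s]}) (A B J : {set 'I_s}) (P : {ffun 'I_s -> K}).

Local Notation coefs := {ffun {set 'I_s} -> K^o}.

(** The analogue of [supported] for polynomials; recording [A] shows which variables are fresh. *)
Definition sqfree_on A d p :=
  forall m, p@_m != 0 -> exists B, [/\ B \subset A, #|B| = d & m = mesym1 B].

Definition sqfree_coefs p : coefs := [ffun B : {set 'I_s} => p@_(mesym1 B)].

Lemma supported_sqfree_coefs A d p :
  sqfree_on A d p -> supported A d (sqfree_coefs p).
Proof.
by move=> pA B; rewrite ffunE => /pA[C [sC cC /inj_mesym1->]].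
Qed.

Lemma mpoly_sqfreeE A d p : sqfree_on A d p ->
  p = \sum_B (sqfree_coefs p B : K) *: 'X_[mesym1 B].
Proof.
move=> pA; apply/mpolyP => m; rewrite raddf_sum /=.
have [pm|/pA[B [_ _ ->]]] := eqVneq p@_m 0.
  rewrite pm big1 // => B _; rewrite mcoeffZ mcoeffX ffunE.
  by case: eqP => [->|_]; rewrite ?pm ?mul0r ?mulr0.
rewrite (bigD1 B) //= big1 ?addr0 => [|C nCB].
  by rewrite mcoeffZ mcoeffX eqxx mulr1 ffunE.
by rewrite mcoeffZ mcoeffX (inj_eq (@inj_mesym1 _)) (negbTE nCB) mulr0.
Qed.

Lemma mevalX_mesym1 P B : ('X_[mesym1 B] : {mpoly K[s]}).@[P] = \prod_(i in B) P i.
Proof.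
rewrite mevalX [RHS]big_mkcond; apply: eq_bigr => i _; rewrite mnmE.
by case: (i \in B); rewrite ?expr1 ?expr0.
Qed.

Lemma meval_sqfree A d p P : sqfree_on A d p -> p.@[P] = eval P (sqfree_coefs p).
Proof.
move=> pA; rewrite {1}(mpoly_sqfreeE pA) raddf_sum /=; apply: eq_bigr => B _.
by rewrite mevalZ mevalX_mesym1.
Qed.

Lemma meval_upd A d p P j x : sqfree_on A d p -> j \notin A ->
  p.@[upd P j x] = p.@[P].
Proof.
move=> pA jA; rewrite !(meval_sqfree _ pA); apply: eval_upd => B jB.
apply/eqP; apply: contraNT jA => /(supported_sqfree_coefs pA)[/subsetP sB _].
exact: sB.
Qed.

Lemma sqfree_mnmP d (m : 'X_{1..s}) :
  reflect (exists2 B : {set 'I_s}, #|B| = d & m = mesym1 B) (sqfree_mnm d m).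
Proof.
apply: (iffP andP) => [[/eqP md /forallP m1]|[B <- ->]].
  have mE : m = mesym1 [set i | m i != 0%N].
    by apply/mnmP => i; rewrite mnmE inE; have := m1 i; case: (m i) => [|[]].
  by exists [set i | m i != 0%N]; rewrite // -mdeg_mesym1 -mE.
split; first by rewrite mdeg_mesym1.
by apply/forallP => i; rewrite mnmE leq_b1.
Qed.

Lemma in_KVP d p : in_KV d p <-> sqfree_on setT d p.
Proof.
split=> [[c ->] m|pT].
  rewrite raddf_sum /= => H.
  suff /sqfree_mnmP[B cB mB] : sqfree_mnm d m by exists B; rewrite subsetT.
  apply: contraNT H => nm; rewrite big1 // => m' sm'.
  rewrite mcoeffZ mcoeffX; case: eqP => [E|]; last by rewrite mulr0.
  by rewrite -E sm' in nm.
exists (fun m => p@_m).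
have pS m : m \in msupp p -> sqfree_mnm d m.
  rewrite mcoeff_msupp => /pT[B [_ cB mB]].
  by apply/sqfree_mnmP; exists B.
(* Every monomial of [p] thus belongs to the bounded index type of [in_KV]. *)
have sz : (msize p <= d.+1)%N.
  rewrite msizeE; apply/bigmax_leqP_seq => m /pS /andP[/eqP-> _] _; exact: leqnn.
rewrite {1}(mpolywE sz) [RHS]big_mkcond; apply: eq_bigr => m _.
case: ifPn => // nm; rewrite memN_msupp_eq0 ?scale0r //.
by apply: contra nm => /pS.
Qed.

Lemma torusE (z : 'I_s) : val z = 0%N -> torus K s = subtorus K (~: [set z]).
Proof.
move=> z0; apply/setP => P; rewrite inE.
apply/andP/subtorusP => [[/forallP H1 /forallP H2]|[H1 H2]].
  split=> i; rewrite !inE ?negbK => iz; first exact: H1.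
  by have := H2 i; rewrite (eqP iz) z0 eqxx => /eqP.
split; apply/forallP => i.
  have [->|iz] := eqVneq i z; last by apply: H1; rewrite !inE.
  by rewrite H2 ?oner_eq0 // !inE eqxx.
apply/implyP => i0; rewrite H2 // !inE negbK; apply/eqP/val_inj.
by rewrite z0; apply/eqP.
Qed.

Local Notation q1 := (#|K|.-1%:R : rat).

Lemma torus_minus_zeros r (f : 'I_r -> {mpoly K[s]}) :
  torus K s :\: zeros f = [set P in torus K s | [exists i, (f i).@[P] != 0]].
Proof.
apply/setP => P; rewrite in_setD [P \in zeros f]inE [RHS]inE negb_and negb_forall.
by case: (P \in torus K s); rewrite ?andbF ?andbT.
Qed.

(** [nonzeros_bound] is applied to the span of the coefficient functions. Its dimension is [r]
    because the polynomials themselves are independent, so q = 2 needs no separate treatment. *)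
Lemma ghw_lower_bound d r (f : 'I_r -> {mpoly K[s]}) : (0 < s)%N -> (d <= s)%N ->
    (forall i, in_KV d (f i)) -> lin_indep f ->
  q1 ^+ s.-1 * (1 - q1^-1) ^+ (s - d) * geom q1^-1 r <= #|torus K s :\: zeros f|%:R.
Proof.
move=> s0 ds fKV find.
pose z := Ordinal s0; pose J := ~: [set z].
have zJ : z \notin J by rewrite !inE eqxx.
have zJT : z |: J = setT by rewrite setUCr.
have cJ : #|J| = s.-1 by rewrite cardsC1 card_ord.
have fT i : sqfree_on setT d (f i) by apply/in_KVP.
pose X : r.-tuple coefs := [tuple sqfree_coefs (f i) | i < r].
have XE (i : 'I_r) : X`_i = sqfree_coefs (f i) by rewrite -tnth_nth tnth_mktuple.
pose W := <<X>>%VS.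
have dW : \dim W = r.
  suff /eqP-> : free X by rewrite size_tuple.
  apply/freeP => k k0; apply: find.
  under eq_bigr => i _ do rewrite (mpoly_sqfreeE (fT i)) scaler_sumr.
  rewrite exchange_big /= big1 // => B _.
  under eq_bigr => i _ do rewrite scalerA.
  rewrite -scaler_suml.
  suff -> : \sum_i k i * sqfree_coefs (f i) B = 0 by rewrite scale0r.
  have /ffunP/(_ B) := k0; rewrite sum_ffunE ffunE => E; rewrite -[RHS]E.
  by apply: eq_bigr => i _; rewrite XE [RHS]ffunE.
have WJ c : c \in W -> supported (z |: J) d c.
  move=> /coord_span -> B; rewrite sum_ffunE => H.
  have [i ci] : exists i : 'I_r, X`_i B != 0.
    apply/existsP; apply: contraNT H; rewrite negb_exists => /forallP H.
    rewrite big1 // => i _; rewrite ffunE.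
    by have := H i; rewrite negbK => /eqP ->; rewrite scaler0.
  by move: ci; rewrite XE zJT => /(supported_sqfree_coefs (fT i)).
have := @nonzeros_bound K _ z J d (s - d) W zJ _ WJ.
rewrite cJ dW (prednK s0) subnKC // => /(_ erefl); congr (_ <= _%:R).
rewrite torus_minus_zeros (@torusE z) //; apply: eq_card => P.
rewrite !in_set; congr (_ && _); apply/idP/idP => [|/existsP[i fi]].
  apply: contraNT; rewrite negb_exists => /forallP H.
  apply/span_subvP => c /tnthP[i ->]; rewrite tnth_mktuple memv_ker lfunE /=.
  by rewrite -(meval_sqfree _ (fT i)) -[_ == _]negbK.
apply/nonzerosP; exists (sqfree_coefs (f i)); last by rewrite -(meval_sqfree _ (fT i)).
by apply/memv_span/tnthP; exists i; rewrite tnth_mktuple.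
Qed.

(** * Polynomials attaining the bound *)

Lemma mesym1_setU1 a B : a \notin B -> mesym1 (a |: B) = (U_(a) + mesym1 B)%MM.
Proof.
move=> aB; apply/mnmP => i; rewrite mnmDE mnm1E !mnmE !inE eq_sym.
by case: eqP => //= <-; rewrite (negbTE aB).
Qed.

Lemma sqfree_onMX a A d p : a \notin A -> sqfree_on A d p ->
  sqfree_on (a |: A) d.+1 ('X_a * p).
Proof.
move=> aA pA m; rewrite mulrC -mcoeff_msupp (perm_mem (msuppMX _ _)).
case/mapP => m'; rewrite mcoeff_msupp => /pA[B [sB cB ->]] ->.
have aB : a \notin B by apply: contra aA; apply: subsetP.
exists (a |: B); split; first exact: setUS.
  by rewrite cardsU1 aB cB.
by rewrite mesym1_setU1.
Qed.

Lemma sqfree_onB A d p p' : sqfree_on A d p -> sqfree_on A d p' ->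
  sqfree_on A d (p - p').
Proof.
move=> pA pA' m; rewrite mcoeffB; have [->|/pA //] := eqVneq p@_m 0.
by rewrite sub0r oppr_eq0 => /pA'.
Qed.

Lemma sqfree_onX A B d : B \subset A -> #|B| = d ->
  sqfree_on A d 'X_[K, mesym1 B].
Proof.
move=> sB cB m; rewrite mcoeffX; have [<-|_] := eqVneq (mesym1 B) m; last by rewrite eqxx.
by exists B.
Qed.

Lemma sqfree_onS A A' d p : A \subset A' -> sqfree_on A d p -> sqfree_on A' d p.
Proof. by move=> sA pA m /pA[B [sB ? ?]]; exists B; rewrite (subset_trans sB). Qed.

Definition nonvanishing J r (f : 'I_r -> {mpoly K[s]}) :=
  [set P in subtorus K J | [exists i, (f i).@[P] != 0]].

(* The polynomials Y / y_i - Y / z, with Y the product of all the variables,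
   vanish together exactly where all the y_i equal z. *)
Lemma extremal_family_base z J d r : z \notin J -> #|J| = d -> (r <= d)%N ->
  exists f : 'I_r -> {mpoly K[s]},
    [/\ forall i, sqfree_on (z |: J) d (f i), lin_indep f
      & #|nonvanishing J f|%:R <= q1 ^+ #|J| * (1 - q1^-1) * geom q1^-1 r].
Proof.
move=> zJ cJ rd; have rJ : (r <= #|J|)%N by rewrite cJ.
pose y (i : 'I_r) : 'I_s := enum_val (widen_ord rJ i).
have yJ i : y i \in J by apply: enum_valP.
have y_inj : injective y by move=> i j /enum_val_inj /(congr1 val) /= /val_inj.
have yz i : y i != z by apply: contraNneq zJ => <-.
(* With Y the product over [z |: J], the set [A i] encodes Y / y_i and [J] encodes Y / z. *)
pose A i := (z |: J) :\ y i.
have zA i : z \in A i by rewrite !inE eqxx eq_sym yz.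
have A_inj i j : (A i == A j) = (i == j).
  apply/eqP/eqP => [/setP/(_ (y i))|-> //].
  rewrite !inE eqxx yJ orbT andbT /= => H; apply: y_inj; apply/eqP.
  by move/esym/negbT: H; rewrite andbT negbK.
have JA i : (J == A i) = false by apply: contraNF zJ => /eqP->.
have cA i : #|A i| = d.
  have := cardsD1 (y i) (z |: J); rewrite cardsU1 zJ cJ !inE yJ orbT.
  by rewrite -/(A i) => -[].
exists (fun i => 'X_[mesym1 (A i)] - 'X_[mesym1 J]); split.
- move=> i; apply: sqfree_onB; apply: sqfree_onX => //; first exact: subsetDl.
  exact: subsetUr.
(* The monomial of [A j] occurs in the [j]-th polynomial alone, so its coefficient isolates
   [c j]. *)
- move=> c /(congr1 (fun p => p@_(mesym1 (A _)))) c0 j; have := c0 j.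
  rewrite raddf_sum mcoeff0 /= (bigD1 j) //= big1 ?addr0 => [|i ij].
    rewrite mcoeffZ mcoeffB !mcoeffX eqxx (inj_eq (@inj_mesym1 _)) JA.
    by rewrite subr0 mulr1.
  rewrite mcoeffZ mcoeffB !mcoeffX !(inj_eq (@inj_mesym1 _)) JA A_inj.
  by rewrite (negbTE ij) subr0 mulr0.
pose Y := [set y i | i : 'I_r].
have sYJ : Y \subset J by apply/subsetP => _ /imsetP[i _ ->].
have cY : #|Y| = r by rewrite card_imset // card_ord.
have sT : subtorus K (J :\: Y) \subset subtorus K J.
  apply/subsetP => P /subtorusP[H1 H2]; apply/subtorusP; split=> i iJ.
    have [iY|iY] := boolP (i \in Y); last by apply: H1; rewrite inE iY.
    by rewrite H2 ?oner_eq0 // inE iY.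
  by rewrite H2 // inE (negbTE iJ) andbF.
(* As z = 1 on the subtorus, the common zeros are the points where every [y i] is 1, again a
   subtorus. *)
have -> : nonvanishing J (fun i => 'X_[mesym1 (A i)] - 'X_[mesym1 J])
   = subtorus K J :\: subtorus K (J :\: Y).
  apply/setP => P; rewrite in_setD inE andbC.
  have [PJ|_] := boolP (P \in subtorus K J); rewrite ?andbF ?andbT //.
  have [H1 H2] := subtorusP _ _ PJ.
  have fE i : ('X_[mesym1 (A i)] - 'X_[mesym1 J] : {mpoly K[s]}).@[P] =
              (\prod_(k in A i) P k) * (1 - P (y i)).
    rewrite mevalB !mevalX_mesym1 mulrBr mulr1; congr (_ - _).
    have <- : \prod_(k in z |: J) P k = \prod_(k in J) P k.
      by rewrite big_setU1 //= H2 // mul1r.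
    by rewrite (big_setD1 (y i)) ?inE ?yJ ?orbT //= mulrC.
  have An0 i : \prod_(k in A i) P k != 0.
    apply/prodf_neq0 => k; rewrite !inE => /andP[_ /orP[/eqP->|/H1//]].
    by rewrite H2 // oner_eq0.
  apply/existsP/idP => [[i]|].
    apply: contra => /subtorusP[_ H]; rewrite fE H ?subrr ?mulr0 //.
    by rewrite inE negb_and negbK imset_f.
  move=> H; apply/existsP; apply: contraNT H; rewrite negb_exists => /forallP H.
  apply/subtorusP; split=> i; rewrite inE => iJ; first by apply: H1; case/andP: iJ.
  have [/imsetP[k _ ->]|iY] := boolP (i \in Y); last first.
    by apply: H2; move: iJ; rewrite iY.
  have := H k; rewrite negbK fE mulf_eq0 (negbTE (An0 k)) /= subr_eq0.
  by move/eqP.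
have Q0 : q1 != 0 by rewrite gt_eqF // (lt_le_trans ltr01 (q1_ge1 K)).
rewrite cardsD (setIidPr sT) natrB ?subset_leq_card // !card_subtorus.
rewrite cardsD (setIidPr sYJ) cY -mulrA geomM !natrX mulrBr mulr1 exprVn.
by rewrite expfB_cond ?(negbTE Q0).
Qed.

(** Each factor a - b takes two variables out of [J], raises the degree by one and multiplies the
    count by Q (Q - 1) = Q^2 p. After removing [e] factors, [J] has d - e variables and the degree
    is d - e, so [e + r <= d] leaves room for the [r] variables y_i. *)
Lemma extremal_family z J d e r : z \notin J -> (#|J|.+1 = d + e.+1)%N ->
    (e + r <= d)%N ->
  exists f : 'I_r -> {mpoly K[s]},
    [/\ forall i, sqfree_on (z |: J) d (f i), lin_indep f
      & #|nonvanishing J f|%:R <= q1 ^+ #|J| * (1 - q1^-1) ^+ e.+1 * geom q1^-1 r].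
Proof.
elim: e J d => [|e IHe] J d zJ cJ rd.
  by rewrite expr1; apply: extremal_family_base => //; lia.
have /card_gt1P[a [b [aJ bJ ab]]] : (1 < #|J|)%N by lia.
pose J' := J :\ b :\ a.
have aJb : a \in J :\ b by rewrite !inE ab.
have cJb : #|J| = #|J :\ b|.+1 by rewrite (cardsD1 b) bJ.
have cJ2 : #|J :\ b| = #|J'|.+1 by rewrite (cardsD1 a) aJb.
have zJ' : z \notin J' by rewrite !inE (negbTE zJ) !andbF.
have anJ' : a \notin z |: J'.
  by rewrite !inE eqxx orbF; apply: contraNneq zJ => <-.
have bnJ' : b \notin z |: J'.
  by rewrite !inE eqxx !andbF orbF; apply: contraNneq zJ => <-.
have [||f [fJ find fle]] := IHe J' d.-1 zJ'; [by lia..|].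
exists (fun i => ('X_a - 'X_b) * f i); split.
- move=> i; rewrite mulrBl; apply: sqfree_onB.
    apply: (@sqfree_onS (a |: (z |: J'))).
      by apply/subsetP => x; rewrite !inE => /or3P[/eqP->|->//|/and3P[_ _ ->]];
        rewrite ?aJ ?orbT.
    by have -> : d = d.-1.+1 by [lia]; apply: sqfree_onMX.
  apply: (@sqfree_onS (b |: (z |: J'))).
    by apply/subsetP => x; rewrite !inE => /or3P[/eqP->|->//|/and3P[_ _ ->]];
        rewrite ?bJ ?orbT.
  by have -> : d = d.-1.+1 by [lia]; apply: sqfree_onMX.
- move=> c; under eq_bigr do rewrite scalerAr.
  rewrite -mulr_sumr => /eqP; rewrite mulf_eq0 => /orP[|/eqP/find //].
  (* The factor is not the zero polynomial: its coefficient at ['X_a] is 1. *)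
  move/eqP/mpolyP/(_ U_(a)%MM); rewrite mcoeffB mcoeff0 !mcoeffXU eqxx.
  by rewrite eq_sym (negbTE ab) subr0 => /eqP; rewrite oner_eq0.
have -> : #|nonvanishing J (fun i => ('X_a - 'X_b) * f i)| =
    (#|nonvanishing J' f| * (#|K|.-1 * #|K|.-2))%N.
  rewrite -sum1dep_card big_mkcondr (sum_subtorus _ bJ) (sum_subtorus _ aJb).
  rewrite -[#|nonvanishing J' f|]sum1dep_card big_mkcondr big_distrl /=.
  apply: eq_bigr => P _.
  (* [f i] involves neither [a] nor [b], so these coordinates only affect the factor x - y. *)
  have vE x y : [exists i, (('X_a - 'X_b) * f i).@[upd (upd P a x) b y] != 0]
      = (x != y) && [exists i, (f i).@[P] != 0].
    have E i : (('X_a - 'X_b) * f i).@[upd (upd P a x) b y] = (x - y) * (f i).@[P].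
      rewrite mevalM mevalB !mevalXU (meval_upd _ _ (fJ i) bnJ').
      by rewrite (meval_upd _ _ (fJ i) anJ') !ffunE !eqxx (negbTE ab).
    apply/existsP/andP => [[i]|[xy /existsP[i fi]]].
      rewrite E mulf_eq0 subr_eq0 negb_or => /andP[? ?].
      by split=> //; apply/existsP; exists i.
    by exists i; rewrite E mulf_neq0 // subr_eq0.
  have [fP|nfP] := boolP [exists i, (f i).@[P] != 0]; last first.
    by rewrite big1 // => x _; rewrite big1 // => y _; rewrite vE (negbTE nfP) andbF.
  rewrite mul1n -(card_neq0 K) -sum_nat_const; apply: eq_bigr => x x0.
  under eq_bigr do rewrite vE fP andbT.
  rewrite -big_mkcondr sum1_card (cardD1 x [pred y : K | y != 0]) inE x0.
  by apply: eq_card => y; rewrite !inE -topredE /= andbC eq_sym.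
rewrite !natrM q1M cJb cJ2.
have -> : q1 ^+ #|J'|.+2 * (1 - q1^-1) ^+ e.+2 * geom q1^-1 r =
  q1 ^+ #|J'| * (1 - q1^-1) ^+ e.+1 * geom q1^-1 r * (q1 * (q1 * (1 - q1^-1))).
  by rewrite !exprS; ring.
by rewrite ler_wpM2r // !mulr_ge0 ?ler0n // subr_ge0 q1V_le1.
Qed.

End SquareFreePolynomials.

(** * The closed formula and the theorem *)

(** For d < s, one factor p closes the geometric sum to 1 - Q^(-r), and the other s - d - 1 factors
    combine with powers of Q through q - 2 = Q p. *)
Lemma ghw_formulaE (q s d r : nat) : (1 < q)%N -> (1 <= d <= s)%N -> (1 <= r)%N ->
    (d == s -> r = 1%N) -> (s + r <= 2 * d + 1)%N ->
  ghw_formula q s d r = (q.-1%:R : rat) ^+ s.-1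
    * (1 - (q.-1%:R : rat)^-1) ^+ (s - d) * geom (q.-1%:R : rat)^-1 r.
Proof.
move=> q1 /andP[d1 ds] r1 dsr sdr.
case: q q1 => [|[|n]] // _; rewrite /ghw_formula /=.
have -> : n.+2%:R - 1 = n.+1%:R :> rat by ring.
have -> : n.+2%:R - 2 = n%:R :> rat by ring.
have u : n.+1%:R != 0 :> rat by rewrite pnatr_eq0.
have nE : n%:R = n.+1%:R * (1 - n.+1%:R^-1) :> rat.
  by rewrite mulrBr mulr1 divff //; ring.
(* For d = s the factor (q - 2)^(-1) cancels against (q - 1)^1 - 1, except for q = 2, where the
   formula is 1 by convention. *)
have [E|nds] := eqVneq d s.
  rewrite E subnn expr0 mulr1 (dsr _) ?E ?eqxx // /geom big_ord1 expr0 mulr1 andbT.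
  case: eqP => [[->]|/eqP n0]; first by rewrite expr1n.
  have n0' : n%:R != 0 :> rat by rewrite pnatr_eq0; apply: contra n0 => /eqP->.
  have -> : s%:Z - s%:Z - 1 = -1 by lia.
  have -> : s%:Z - 1%:Z = s.-1%:Z by lia.
  rewrite expr1 exprN1 -exprnP -mulrA mulrC.
  have -> : n.+1%:R - 1 = n%:R :> rat by ring.
  by rewrite mulfK.
rewrite andbF.
have -> : s%:Z - d%:Z - 1 = (s - d).-1%:Z by lia.
(* As d < s, the inequality between s, d and r gives r <= d, so the natural subtraction is not
   truncated. *)
have -> : d%:Z - r%:Z = (d - r)%:Z by lia.
rewrite -!exprnP.
have [k Ek] : exists k, (s - d = k.+1)%N by exists (s - d).-1; lia.
have -> : s.-1 = (k + (d - r) + r)%N by lia.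
rewrite Ek /= exprS.
rewrite (mulrC (1 - _)) !mulrA -[RHS]mulrA geomM nE exprMn !exprD.
have -> : n.+1%:R ^+ r - 1 = n.+1%:R ^+ r * (1 - n.+1%:R^-1 ^+ r) :> rat.
  by rewrite mulrBr mulr1 exprVn divff // expf_neq0.
by rewrite !mulrA; congr (_ * _); ring.
Qed.

Theorem theorem4p4 (K : finFieldType) (s d r : nat)
    (hs : (2 <= s)%N) (hd : (1 <= d <= s)%N) (hr : (1 <= r <= 'C(s, d))%N)
    (hsdr : s%:Z < 2 * d%:Z - r%:Z + 2) :
  exists w : nat, is_ghw K s d r w /\ w%:R = ghw_formula #|K| s d r.
Proof.
have [d1 ds] := andP hd; have [r1 rC] := andP hr.
have s0 : (0 < s)%N by lia.
have dsr : d == s -> r = 1%N.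
  by move/eqP => E; move: r1 rC; rewrite E binn; lia.
pose z := Ordinal s0; pose J := ~: [set z].
have zJ : z \notin J by rewrite !inE eqxx.
have cJ : #|J| = s.-1 by rewrite cardsC1 card_ord.
have bound := ghw_lower_bound s0 ds.
have [f [fKV find fle]] : exists f : 'I_r -> {mpoly K[s]},
    [/\ forall i, in_KV d (f i), lin_indep f
      & #|torus K s :\: zeros f|%:R <= (#|K|.-1%:R : rat) ^+ s.-1
          * (1 - (#|K|.-1%:R : rat)^-1) ^+ (s - d) * geom (#|K|.-1%:R : rat)^-1 r].
  (* The extremal family needs d < s. For d = s the only monomial is the product of all variables,
     and the size of the whole torus already is the bound. *)
  have [E|nds] := eqVneq d s.
    move: (dsr); rewrite E eqxx => /(_ isT) ->.
    exists (fun=> 'X_[mesym1 setT]); split.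
    - by move=> i; apply/in_KVP/sqfree_onX; rewrite // cardsT card_ord.
    - move=> c; rewrite big_ord1 => /mpolyP/(_ (mesym1 setT)).
      by rewrite mcoeffZ mcoeffX eqxx mcoeff0 mulr1 => c0 i; rewrite ord1.
    rewrite subnn expr0 mulr1 /geom big_ord1 expr0 mulr1 -natrX ler_nat.
    rewrite -cJ -card_subtorus -(@torusE K s z) //.
    exact/subset_leq_card/subsetDl.
  (* With e = s - d - 1, the condition e + r <= d is exactly s < 2d - r + 2. *)
  have [||f [fJ find fle]] := @extremal_family K s z J d (s - d).-1 r zJ.
  - by rewrite cJ; lia.
  - by lia.
  exists f; split=> //.
    by move=> i; apply/in_KVP; apply: sqfree_onS (fJ i); apply: subsetT.
  rewrite torus_minus_zeros (@torusE K s z) //.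
  by move: fle; rewrite cJ prednK // subn_gt0 ltn_neqAle nds.
have wE : #|torus K s :\: zeros f|%:R = ghw_formula #|K| s d r.
  rewrite ghw_formulaE ?card_finNzRing_gt1 //; last by lia.
  by apply/le_anti; rewrite fle bound.
exists #|torus K s :\: zeros f|; split=> //; split; first by exists f.
move=> _ [g [gKV gind ->]]; rewrite -(ler_nat rat).
exact: le_trans fle (bound _ _ _ gKV gind).
Qed.
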